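(* Every hypotopology is countably deep. Moreover, for every convergence $\xi$, $$\mathrm{P}_1\xi\ \geq\ (\mathrm{P}_1\triangle \mathrm{S})\xi\ \geq\ \mathrm{S}_{\wedge 1}\xi .$$
   Context: Filters on $X$ are families of nonempty subsets closed under finite intersections and supersets, ordered by inclusion ($\leq$); $\bigwedge$ is intersection. Two families of sets mesh, $\mathcal{A}\#\mathcal{B}$, if $A\cap B\neq\emptyset$ for all $A\in\mathcal{A},B\in\mathcal{B}$. A convergence $\xi$ on $X$ is a relation between points and filters, written $x\in\lim_\xi\mathcal{F}$, such that $x\in\lim_\xi\{x\}^{\uparrow}$ for all $x$ (where $\{x\}^\uparrow$ is the principal ultrafilter of $x$), and $\mathcal{F}\subset\mathcal{G}$ implies $\lim_\xi\mathcal{F}\subset\lim_\xi\mathcal{G}$. For convergences on the same set, $\xi\geq\theta$ ($\xi$ finer, $\theta$ coarser) means $\lim_\xi\mathcal{F}\subset\lim_\theta\mathcal{F}$ for every filter $\mathcal{F}$. The adherence of a filter $\mathcal{H}$ is $\mathrm{adh}_\xi\mathcal{H}=\bigcup_{\mathcal{F}\#\mathcal{H}}\lim_\xi\mathcal{F}$ (union over filters $\mathcal{F}$ on $X$). $\mathrm{S}_{\wedge1}\xi$ is the convergence defined by $\lim_{\mathrm{S}_{\wedge1}\xi}\mathcal{F}=\bigcap\{\mathrm{adh}_\xi\mathcal{D}:\mathcal{D}\in\mathbb{F}_{\wedge1}X,\ \mathcal{D}\#\mathcal{F}\}$, where $\mathbb{F}_{\wedge1}X$ is the set of filters on $X$ closed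 under countable intersections. $\xi$ is a hypotopology if $\xi=\mathrm{S}_{\wedge1}\xi$. $\xi$ is a pseudotopology if $\lim_\xi\mathcal{F}=\bigcap\{\lim_\xi\mathcal{U}:\mathcal{U}\supset\mathcal{F}\text{ an ultrafilter}\}$ for every filter $\mathcal{F}$. $\xi$ is countably deep if $\lim_\xi\bigwedge_{\mathcal{F}\in\mathbb{A}}\mathcal{F}=\bigcap_{\mathcal{F}\in\mathbb{A}}\lim_\xi\mathcal{F}$ for every nonempty countable set $\mathbb{A}$ of filters on $X$. $\mathrm{P}_1\xi$ is the convergence given by: $x\in\lim_{\mathrm{P}_1\xi}\mathcal{F}$ iff there is a countable set $\mathbb{D}$ of filters, each converging to $x$ for $\xi$, with $\mathcal{F}\geq\bigwedge_{\mathcal{D}\in\mathbb{D}}\mathcal{D}$ (it is the finest countably deep convergence coarser than $\xi$). $(\mathrm{P}_1\triangle\mathrm{S})\xi$ denotes the finest countably deep pseudotopology coarser than $\xi$. *)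

(* Defs.v *)
From mathcomp Require Import all_boot all_order.
From mathcomp Require Import boolp classical_sets functions cardinality filter.

Set Implicit Arguments.
Unset Strict Implicit.
Unset Printing Implicit Defensive.

Local Open Scope classical_set_scope.

(* A filter in the sense of convergence theory is a [ProperFilter]. [clim] has
   all set systems as its domain, but [clim_proper] makes it a relation between
   points and filters only: nothing else converges, so that Leibniz equality of
   convergences is the expected one (see [finer_anti]). *)
Record convergence (X : Type) := Convergence {
  clim : set_system X -> set X;
  clim_proper : forall F x, clim F x -> ProperFilter F;
  clim_point : forall x, clim (principal_filter x) x;
  clim_mono : forall F G, ProperFilter F -> ProperFilter G ->
    F `<=` G -> clim F `<=` clim G
}.

Definition finer (X : Type) (xi theta : convergence X) : Prop :=
  forall F, ProperFilter F -> clim xi F `<=` clim theta F.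

Lemma finer_anti (X : Type) (xi theta : convergence X) :
  finer xi theta -> finer theta xi -> xi = theta.
Proof.
case: xi => l p q r; case: theta => l' p' q' r'; rewrite /finer /= => h h'.
have e : l = l'.
  apply/funext => F; apply/seteqP; split => x Fx.
    exact: h (p _ _ Fx) _ Fx.
  exact: h' (p' _ _ Fx) _ Fx.
by subst l'; congr Convergence; exact: Prop_irrelevance.
Qed.

Definition adherence (X : Type) (xi : convergence X) (H : set_system X) :
    set X :=
  \bigcup_(F in [set F | ProperFilter F /\ F `#` H]) clim xi F.

Definition countably_complete_filter (X : Type) (D : set_system X) : Prop :=
  ProperFilter D /\
  forall C : set (set X), countable C -> C `<=` D -> D (\bigcap_(A in C) A).

Section S_wedge1.
Variables (X : Type) (xi : convergence X).

Definition lim_S_wedge1 (F : set_system X) : set X :=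
  [set x | ProperFilter F /\
    (\bigcap_(D in [set D | countably_complete_filter D /\ D `#` F])
      adherence xi D) x].

Lemma lim_S_wedge1_proper F x : lim_S_wedge1 F x -> ProperFilter F.
Proof. by case. Qed.

Lemma lim_S_wedge1_point x : lim_S_wedge1 (principal_filter x) x.
Proof.
split; first exact: principal_filter_proper.
move=> D [_ DF]; exists (principal_filter x); last exact: clim_point.
split; first exact: principal_filter_proper.
by move=> A B FA DB; rewrite setIC; exact: DF.
Qed.

Lemma lim_S_wedge1_mono F G : ProperFilter F -> ProperFilter G ->
  F `<=` G -> lim_S_wedge1 F `<=` lim_S_wedge1 G.
Proof.
move=> _ PG FG x [_ h]; split=> // D [cD DG]; apply: h; split=> // A B DA FB.
exact: DG DA (FG _ FB).
Qed.

Definition S_wedge1 : convergence X :=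
  Convergence lim_S_wedge1_proper lim_S_wedge1_point lim_S_wedge1_mono.

End S_wedge1.

Definition hypotopology (X : Type) (xi : convergence X) : Prop :=
  xi = S_wedge1 xi.

Definition pseudotopology (X : Type) (xi : convergence X) : Prop :=
  forall F, ProperFilter F ->
    clim xi F =
    \bigcap_(U in [set U | UltraFilter U /\ F `<=` U]) clim xi U.

Definition countably_deep (X : Type) (xi : convergence X) : Prop :=
  forall AA : set (set_system X),
    AA !=set0 -> countable AA -> (forall F, AA F -> ProperFilter F) ->
    clim xi (\bigcap_(F in AA) F) = \bigcap_(F in AA) clim xi F.

Section P1.
Variables (X : Type) (xi : convergence X).

Definition lim_P1 (F : set_system X) : set X :=
  [set x | ProperFilter F /\
    exists DD : set (set_system X),
      [/\ countable DD,
          forall D, DD D -> ProperFilter D /\ clim xi D x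
        & \bigcap_(D in DD) D `<=` F]].

Lemma lim_P1_proper F x : lim_P1 F x -> ProperFilter F.
Proof. by case. Qed.

Lemma lim_P1_point x : lim_P1 (principal_filter x) x.
Proof.
split; first exact: principal_filter_proper.
exists [set principal_filter x]; split; first exact: countable1.
  by move=> D ->; split; [exact: principal_filter_proper|exact: clim_point].
by rewrite bigcap_set1.
Qed.

Lemma lim_P1_mono F G : ProperFilter F -> ProperFilter G ->
  F `<=` G -> lim_P1 F `<=` lim_P1 G.
Proof.
move=> _ PG FG x [_ [DD [cDD DDx DDF]]]; split=> //; exists DD; split=> //.
exact: subset_trans DDF FG.
Qed.

Definition P1 : convergence X :=
  Convergence lim_P1_proper lim_P1_point lim_P1_mono.

End P1.

Definition finest_deep_pseudotopology_below (X : Type)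
    (xi theta : convergence X) : Prop :=
  [/\ countably_deep theta, pseudotopology theta, finer xi theta &
      forall theta' : convergence X, countably_deep theta' ->
        pseudotopology theta' -> finer xi theta' -> finer theta theta'].

Section sup_convergence.
Variables (X : Type) (Theta : set (convergence X)).

Definition lim_sup (F : set_system X) : set X :=
  [set x | ProperFilter F /\ forall theta, Theta theta -> clim theta F x].

Lemma lim_sup_proper F x : lim_sup F x -> ProperFilter F.
Proof. by case. Qed.

Lemma lim_sup_point x : lim_sup (principal_filter x) x.
Proof.
by split=> [|theta _]; [exact: principal_filter_proper|exact: clim_point].
Qed.

Lemma lim_sup_mono F G : ProperFilter F -> ProperFilter G ->
  F `<=` G -> lim_sup F `<=` lim_sup G.
Proof.
move=> PF PG FG x [_ h]; split=> // theta Tt.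
exact: clim_mono PF PG FG _ (h _ Tt).
Qed.

Definition sup_convergence : convergence X :=
  Convergence lim_sup_proper lim_sup_point lim_sup_mono.

End sup_convergence.

Lemma bigcap_proper_filter (X : Type) (AA : set (set_system X)) :
  AA !=set0 -> (forall F, AA F -> ProperFilter F) ->
  ProperFilter (\bigcap_(F in AA) F).
Proof.
move=> [F0 AF0] PA; split.
  by move=> /(_ _ AF0); have [] := PA _ AF0.
split=> [F /PA PF|P Q hP hQ F AF|P Q PQ hP F AF].
- exact: filterT.
- have PF := PA _ AF; exact: filterI (hP _ AF) (hQ _ AF).
- have PF := PA _ AF; exact: filterS PQ (hP _ AF).
Qed.

Lemma finest_deep_pseudotopology_exists (X : Type) (xi : convergence X) :
  exists theta, finest_deep_pseudotopology_below xi theta.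
Proof.
pose Theta := [set t : convergence X |
  [/\ countably_deep t, pseudotopology t & finer xi t]].
exists (sup_convergence Theta); split.
- move=> AA A0 cA PA; apply/seteqP; split=> x /=.
    move=> [_ h] F AF; split=> [|t Tt]; first exact: PA.
    have [dt _ _] := Tt.
    by have := h _ Tt; rewrite (dt _ A0 cA PA); exact.
  move=> h; split; first exact: bigcap_proper_filter.
  move=> t Tt; have [dt _ _] := Tt.
  by rewrite (dt _ A0 cA PA) => F AF; have [_] := h _ AF; exact.
- move=> F PF; apply/seteqP; split=> x /=.
    move=> [_ h] U [UU FU]; split=> [|t Tt]; first exact: ultra_proper.
    by apply: clim_mono FU _ (h _ Tt); exact: ultra_proper.
  move=> h; split=> // t Tt; have [_ pt _] := Tt.
  by rewrite (pt _ PF) => U UF; have [_] := h _ UF; exact.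
- by move=> F PF x Fx; split=> // t [_ _]; exact.
- by move=> t dt pt xt F PF x [_]; apply.
Qed.

Lemma finest_deep_pseudotopology_unique (X : Type)
    (xi theta theta' : convergence X) :
  finest_deep_pseudotopology_below xi theta ->
  finest_deep_pseudotopology_below xi theta' -> theta = theta'.
Proof.
move=> [d p f m] [d' p' f' m'].
by apply: finer_anti; [exact: m|exact: m'].
Qed.

Definition P1_triangle_S (X : Type) (xi : convergence X) : convergence X :=
  sval (cid (finest_deep_pseudotopology_exists xi)).

(* Main.v *)
(** As [F] enters [lim_S_wedge1] only through the filters that mesh with it,
    everything reduces to two facts about a countably
    complete filter [D]: if it meshes with a countable intersection of filters
    then it meshes with one of them (whence [S_wedge1 xi] is countably deep),
    and if it meshes with [F] then it meshes with an ultrafilter finer than [F]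
    (whence [S_wedge1 xi] is a pseudotopology). *)
Require Import Defs.
From mathcomp Require Import all_boot all_order.
From mathcomp Require Import boolp classical_sets functions cardinality filter.

Set Implicit Arguments.
Unset Strict Implicit.
Unset Printing Implicit Defensive.

Local Open Scope classical_set_scope.

(** [F] itself witnesses that its limits lie in the adherence of any filter meshing with it. *)
Lemma finer_S_wedge1 (X : Type) (xi : convergence X) : finer xi (S_wedge1 xi).
Proof.
move=> F PF x Fx; split=> // D [_ DF]; exists F => //; split=> //.
by rewrite meetsC.
Qed.

(* Otherwise each [F] in [AA] contains a set missed by some member of [D]; the
   union of the former and the countable intersection of the latter are
   disjoint. *)
Lemma countably_complete_meets_bigcap (X : Type) (AA : set (set_system X))
    (D : set_system X) :
  countable AA -> (forall F, AA F -> ProperFilter F) ->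
  countably_complete_filter D -> D `#` \bigcap_(F in AA) F ->
  exists2 F, AA F & D `#` F.
Proof.
move=> cA PA [_ cD] DA; apply: contrapT => nA.
have /choice[g gP] F : exists AB : set X * set X,
    AA F -> [/\ D AB.1, F AB.2 & AB.1 `&` AB.2 = set0].
  (* Outside [AA] the pair is a mere default, since [choice] asks for a total function. *)
  have [AF|] := pselect (AA F); last by exists (set0, set0).
  apply: contrapT => nF; apply: nA; exists F => // A B DDA FB.
  apply/set0P/eqP => AB0; apply: nF; by exists (A, B).
have DI : D (\bigcap_(A in (fst \o g) @` AA) A).
  apply: cD; last by move=> _ [F AF <-]; case: (gP _ AF).
  exact: sub_countable (card_image_le _ _) cA.
have AU : (\bigcap_(F in AA) F) (\bigcup_(F in AA) (g F).2).
  move=> F AF; have PF := PA _ AF; have [_ FB _] := gP _ AF.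
  by apply: filterS FB => y yF; exists F.
have [y [yI [F AF yF]]] := DA _ _ DI AU.
have [_ _ /eqP] := gP _ AF; apply/negP/set0P; exists y; split=> //.
by apply: yI; exists F.
Qed.

Lemma S_wedge1_countably_deep (X : Type) (xi : convergence X) :
  countably_deep (S_wedge1 xi).
Proof.
move=> AA A0 cA PA; apply/seteqP; split=> x Ax.
  move=> F AF; apply: clim_mono Ax; first exact: bigcap_proper_filter.
    exact: PA.
  exact: bigcap_inf.
split; first exact: bigcap_proper_filter.
move=> D [cD DA]; have [F AF DF] := countably_complete_meets_bigcap cA PA cD DA.
by have [_] := Ax _ AF; exact.
Qed.

(** The intersections of a member of [D] with a member of [F] generate a proper filter. An
    ultrafilter above it contains both [D] and [F], so its members meet those of [D]. *)
Lemma meets_ultra (X : Type) (D F : set_system X) :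
  ProperFilter D -> ProperFilter F -> D `#` F ->
  exists U, [/\ UltraFilter U, F `<=` U & D `#` U].
Proof.
move=> PD PF DF.
pose G := filter_from [set AB : set X * set X | D AB.1 /\ F AB.2]
  (fun AB => AB.1 `&` AB.2).
have PG : ProperFilter G.
  apply: filter_from_proper => [|[A B] [DA FB]]; last exact: DF.
  apply: filter_from_filter; first by exists (setT, setT); split; exact: filterT.
  move=> [A B] [A' B'] [/= DA FB] [/= DA' FB'].
  by exists (A `&` A', B `&` B'); [split; exact: filterI|rewrite setIACA].
have [U [UU GU]] := ultraFilterLemma PG.
exists U; split=> // [B FB|A B DA UB].
  by apply: GU; exists (setT, B) => [|y []//]; split=> //; exact: filterT.
apply: (@filter_ex _ U); apply: filterI UB; apply: GU.
by exists (A, setT) => [|y []//]; split=> //; exact: filterT.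
Qed.

Lemma S_wedge1_pseudotopology (X : Type) (xi : convergence X) :
  pseudotopology (S_wedge1 xi).
Proof.
move=> F PF; apply/seteqP; split=> x Fx.
  move=> U [UU FU]; apply: clim_mono FU _ Fx; exact: ultra_proper.
split=> // D [cD DF]; have [U [UU FU DU]] := meets_ultra cD.1 PF DF.
by have [_] := Fx U (conj UU FU); exact.
Qed.

(** This is the maximality half of the description of [P1 xi] as the finest countably deep
    convergence coarser than [xi]. *)
Lemma P1_finer_countably_deep (X : Type) (xi theta : convergence X) :
  countably_deep theta -> finer xi theta -> finer (P1 xi) theta.
Proof.
move=> dt xt F PF x [_ [DD [cDD DDx DDF]]].
(* The intersection of an empty family contains every set, [set0] included, which the proper filter
   [F] excludes. *)
have DD0 : DD !=set0.
  apply/set0P/eqP => D0; apply: (@filter_not_empty _ F PF); apply: DDF.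
  by rewrite D0 bigcap_set0.
have PDD D : DD D -> ProperFilter D by case/DDx.
apply: clim_mono DDF _ _ => //; first exact: bigcap_proper_filter.
by rewrite dt // => D /DDx[PD]; exact: xt.
Qed.

Theorem theorem90 (X : Type) :
  (forall xi : convergence X, hypotopology xi -> countably_deep xi) /\
  (forall xi : convergence X,
     finer (P1 xi) (P1_triangle_S xi) /\
     finer (P1_triangle_S xi) (S_wedge1 xi)).
Proof.
split=> xi; first by move=> ->; exact: S_wedge1_countably_deep.
rewrite /P1_triangle_S; case: cid => theta /= [dt _ xt fine]; split.
  exact: P1_finer_countably_deep.
(* By maximality of [theta], it suffices that [S_wedge1 xi] is itself a countably deep
   pseudotopology coarser than [xi]. *)
apply: fine; [exact: S_wedge1_countably_deep|exact: S_wedge1_pseudotopology|].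
exact: finer_S_wedge1.
Qed.
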